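(* For each positive integer $n$, place $n$ rooks on distinct squares of an $n\times n$ chessboard, uniformly at random among all $\binom{n^2}{n}$ configurations, and let $S_n$ be the number of safe squares. Then the expected number of safe squares is asymptotically $n^2/e^2$, that is, $$\lim_{n\to\infty}\frac{\mathbb{E}[S_n]}{n^2}=\frac{1}{e^2},$$ so the expected percentage of safe squares converges to $100/e^2\approx 13.53\%$.
   Context: A configuration $\mathcal{B}$ is a set of $n$ distinct squares of the $n\times n$ board (the squares occupied by rooks); each configuration has probability $1/\binom{n^2}{n}$. A square $(i,j)$, $1\le i,j\le n$, is safe under $\mathcal{B}$ if no rook of $\mathcal{B}$ lies in row $i$ or in column $j$ (in particular $(i,j)$ is not itself occupied). $S_n(\mathcal{B})$ is the number of squares safe under $\mathcal{B}$. *)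

(* Defs.v *)
From mathcomp Require Import all_boot all_order all_algebra.
From mathcomp Require Import reals.

Set Implicit Arguments.
Unset Strict Implicit.
Unset Printing Implicit Defensive.

Import Order.TTheory GRing.Theory Num.Theory.

Local Open Scope ring_scope.

Definition square (n : nat) : finType := ('I_n * 'I_n)%type.

Definition configs (n : nat) : {set {set square n}} :=
  [set B : {set square n} | #|B| == n].

Definition safe (n : nat) (B : {set square n}) (s : square n) : bool :=
  [forall r in B, (r.1 != s.1) && (r.2 != s.2)].

Definition num_safe (n : nat) (B : {set square n}) : nat :=
  #|[set s : square n | safe B s]|.

Definition config_prob (R : realType) (n : nat) : R := ('C(n ^ 2, n)%:R)^-1.

Definition config_expectation (R : realType) (n : nat) (X : {set square n} -> R) : R :=
  \sum_(B in configs n) config_prob R n * X B.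

Lemma card_configs (n : nat) : #|configs n| = 'C(n ^ 2, n).
Proof. by rewrite card_draws card_prod card_ord mulnn. Qed.

Lemma sum_config_prob (R : realType) (n : nat) :
  \sum_(B in configs n) config_prob R n = 1.
Proof.
rewrite sumr_const card_configs -[LHS]mulr_natr mulVf // pnatr_eq0 -lt0n.
rewrite bin_gt0; case: n => // n.
by rewrite -[X in (X <= _)%N]expn1 leq_pexp2l.
Qed.

(* Main.v *)
Require Import Defs.
From mathcomp Require Import all_boot all_order all_algebra.
From mathcomp Require Import all_classical all_reals all_analysis.
From mathcomp Require Import ring lra zify.

(** By linearity of expectation, E[S_n] is the sum over the n^2 squares s of
    the probability that s is safe. A square is safe exactly when all rooks lie
    in the (n-1) x (n-1) subboard left after deleting its row and column, so
    this probability does not depend on s: it is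
      'C((n-1)^2, n) / 'C(n^2, n) = \prod_(i < n) ((n-1)^2 - i) / (n^2 - i)
    ([config_expectation_num_safe], [safe_prob_prod]).

    The product is squeezed between exponentials by means of 1 + x <= exp x
    alone. Each factor is at most its value (1 - 1/n)^2 at i = 0, hence at most
    exp(-1/n)^2, and so the product is at most exp(-2)
    ([safe_prob_le_expR]). The inverse of each factor is
    1 + (2n-1) / ((n-1)^2 - i), so the product is at least
    exp(- n(2n-1) / ((n-1)^2 - n)), whose exponent is -2 + O(1/n)
    ([safe_prob_ge_expR]).

    The numerical value of 100 / e^2 is obtained by enclosing e between a
    partial sum of \sum_k 1/k! and that sum plus twice the next term
    ([exp_partial_sum_bounds]). *)

Set Implicit Arguments.
Unset Strict Implicit.
Unset Printing Implicit Defensive.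

Import Order.TTheory GRing.Theory Num.Theory.
Import numFieldNormedType.Exports.

Local Open Scope classical_set_scope.
Local Open Scope ring_scope.

(** * The expected number of safe squares *)

(** A square is safe iff all rooks lie outside its row and column; this turns
    counting configurations into counting subsets of a fixed set. *)
Lemma safe_subsetX n (B : {set square n}) (s : square n) :
  safe B s = (B \subset finset.setX [set~ s.1] [set~ s.2]).
Proof.
apply/forall_inP/fintype.subsetP => [safeB | subB] [i j] rB.
  by rewrite finset.in_setX !inE (safeB _ rB).
by move: (subB _ rB); rewrite finset.in_setX !inE.
Qed.

Lemma card_configs_safe n (s : square n) :
  #|[set B in configs n | safe B s]| = 'C(n.-1 ^ 2, n).
Proof.
have -> : (n.-1 ^ 2)%N = #|finset.setX [set~ s.1] [set~ s.2]|.
  by rewrite cardsX !cardsC1 card_ord mulnn.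
rewrite -cards_draws; apply: eq_card => B.
by rewrite !inE safe_subsetX andbC.
Qed.

Lemma sum_num_safe n :
  (\sum_(B in configs n) num_safe B = n ^ 2 * 'C(n.-1 ^ 2, n))%N.
Proof.
transitivity (\sum_(B in configs n) \sum_(s | safe B s) 1)%N.
  by apply: eq_bigr => B _; rewrite sum1dep_card.
rewrite (exchange_big_dep predT) //=.
under eq_bigr => s _ do rewrite sum1dep_card card_configs_safe.
by rewrite sum_nat_const card_prod card_ord mulnn.
Qed.

Definition safe_prob (R : realType) (n : nat) : R :=
  'C(n.-1 ^ 2, n)%:R / 'C(n ^ 2, n)%:R.

Lemma config_expectation_num_safe (R : realType) n :
  config_expectation (fun B : {set square n} => (num_safe B)%:R : R) =
  n%:R ^+ 2 * safe_prob R n.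
Proof.
rewrite /config_expectation -mulr_sumr -natr_sum sum_num_safe natrM natrX.
by rewrite /safe_prob /config_prob mulrCA [_^-1 * _]mulrC.
Qed.

Lemma config_expectationZ (R : realType) n (a : R) (X : {set square n} -> R) :
  config_expectation (fun B => a * X B) = a * config_expectation X.
Proof.
by rewrite /config_expectation mulr_sumr; apply: eq_bigr => B _; rewrite mulrCA.
Qed.

(** * Exponential bounds for the probability of being safe *)

Lemma bin_ratio_prod (F : numFieldType) (a b n : nat) :
  'C(a, n)%:R / 'C(b, n)%:R = \prod_(i < n) ((a - i)%:R / (b - i)%:R) :> F.
Proof.
have fact_neq0 : n`!%:R != 0 :> F by rewrite pnatr_eq0 -lt0n fact_gt0.
rewrite prodf_div -!natr_prod -!ffact_prod -!bin_ffact !natrM.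
by rewrite -mulf_div divff // mulr1.
Qed.

(** The factors as real quotients: for n >= 3 no subtraction is truncated. *)
Lemma safe_prob_prod (R : realType) n : (3 <= n)%N ->
  safe_prob R n =
  \prod_(i < n) (((n%:R - 1) ^+ 2 - i%:R) / (n%:R ^+ 2 - i%:R)).
Proof.
move=> n3; rewrite /safe_prob bin_ratio_prod; apply: eq_bigr => i _.
have ltin := ltn_ord i.
rewrite !natrB; [|nia|nia].
by rewrite !natrX -subn1 natrB //; lia.
Qed.

(** Here 1 - 1/n <= exp(-1/n) makes the bound hold for each n, with no error
    term. *)
Lemma safe_prob_le_expR (R : realType) n : (3 <= n)%N ->
  safe_prob R n <= expR (- 2).
Proof.
move=> n3; rewrite safe_prob_prod //.
have n3R : 3%:R <= n%:R :> R by rewrite ler_nat.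
have -> : expR (- 2) = \prod_(i < n) expR (- n%:R^-1) ^+ 2 :> R.
  rewrite prodr_const card_ord -exprM mulnC exprM -!expRM_natl.
  by congr expR; field; rewrite gt_eqF//; lra.
apply: ler_prod => i _.
have i0 : 0 <= i%:R :> R by rewrite ler0n.
have lein : i%:R <= n%:R :> R by rewrite ler_nat ltnW.
have den_gt0 : 0 < n%:R ^+ 2 - i%:R :> R by nra.
apply/andP; split; first by apply: divr_ge0; nra.
apply: (@le_trans _ _ ((1 - n%:R^-1) ^+ 2)); last first.
  rewrite ler_sqr ?nnegrE ?expR_ge0 //; first exact: expR_ge1Dx.
  by rewrite subr_ge0 invf_le1; lra.
rewrite ler_pdivrMr //.
set x : R := n%:R^-1.
have xn : n%:R * x = 1 by rewrite divff// gt_eqF//; lra.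
have x0 : 0 <= x by rewrite invr_ge0.
have x1 : x <= 1 by nra.
have -> : n%:R - 1 = n%:R * (1 - x) by rewrite mulrBr xn mulr1.
have sq_le1 : (1 - x) ^+ 2 <= 1 by nra.
rewrite exprMn mulrBr [_ * n%:R ^+ 2]mulrC lerD2l lerN2.
by rewrite ler_piMl.
Qed.

(** Bounding the inverse of a factor from above reduces this to 1 + x <= exp x
    again; c is the value of x at i = n, an upper bound for those at i < n. *)
Lemma safe_prob_ge_expR (R : realType) n : (4 <= n)%N ->
  expR (- (2 + 20 / n%:R)) <= safe_prob R n.
Proof.
move=> n4; rewrite safe_prob_prod ?(ltnW n4) //.
have n4R : 4%:R <= n%:R :> R by rewrite ler_nat.
set t : R := (n%:R - 1) ^+ 2 - n%:R.
have t_gt0 : 0 < t by rewrite /t; nra.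
pose c := (2 * n%:R - 1) / t.
apply: (@le_trans _ _ (\prod_(i < n) expR (- c))).
  rewrite prodr_const card_ord -expRM_natl ler_expR mulrN lerN2 /c mulrA.
  rewrite ler_pdivrMr //.
  have -> : 2 + 20 / n%:R = (2 * n%:R + 20) / n%:R :> R.
    by field; rewrite gt_eqF//; lra.
  rewrite mulrAC ler_pdivlMr ?/t; last by lra.
  (* For n >= 4, twenty is large enough to absorb the error term:
     15 n^2 - 58 n + 20 >= 0. *)
  have : 0 <= 15 * n%:R ^+ 2 - 58 * n%:R + 20 :> R by nra.
  nra.
apply: ler_prod => i _; rewrite expR_ge0 /=.
have i0 : 0 <= i%:R :> R by rewrite ler0n.
have lein : i%:R <= n%:R :> R by rewrite ler_nat ltnW.
have num_gt0 : 0 < (n%:R - 1) ^+ 2 - i%:R :> R by rewrite /t in t_gt0; lra.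
have den_gt0 : 0 < n%:R ^+ 2 - i%:R :> R by nra.
rewrite expRN -[leRHS]invf_div lef_pV2 ?posrE ?expR_gt0 ?divr_gt0 //.
apply: le_trans (expR_ge1Dx c).
have -> : n%:R ^+ 2 - i%:R =
    ((n%:R - 1) ^+ 2 - i%:R) + (2 * n%:R - 1) :> R by ring.
rewrite mulrDl divff ?gt_eqF // lerD2l /c ler_wpM2l //; first by lra.
by rewrite lef_pV2 ?posrE // /t; lra.
Qed.

Lemma cvg_safe_prob (R : realType) :
  safe_prob R n @[n --> \oo] --> (expR (- 2) : R).
Proof.
rewrite -cvg_shiftS.
apply: (@squeeze_cvgr _ _ _ _ (fun n => expR (- (2 + 20 * harmonic n)))
          (fun=> expR (- 2))); last exact: cvg_cst.
  near=> n; have n3 : (3 <= n)%N by near: n; exact: nbhs_infty_ge.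
  by rewrite safe_prob_ge_expR //= safe_prob_le_expR // ltnW.
apply: continuous_cvg; first exact: continuous_expR.
rewrite (_ : - 2 = - (2 + 20 * 0) :> R); last by rewrite mulr0 addr0.
by apply: cvgN; apply: cvgD; [exact: cvg_cst|apply: cvgMl_tmp; exact: cvg_harmonic].
Unshelve. all: by end_near. Qed.

(** * The numerical value of 100 / e^2 *)

(** Doubling the next term bounds the tail because the partial sum up to m
    plus 2/m! is nonincreasing for m >= 1: passing from m to m + 1 changes it
    by 2/(m+1)! - 1/m! <= 0. *)
Lemma exp_partial_sum_bounds (R : realType) m : (0 < m)%N ->
  series (exp_coeff (1 : R)) m <= expR 1
    <= series (exp_coeff (1 : R)) m + 2 / m`!%:R.
Proof.
move=> m0; have cv := @is_cvg_series_exp_coeff R 1.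
have coeff_ge0 k : 0 <= exp_coeff (1 : R) k by rewrite /exp_coeff /= expr1n divr_ge0.
have mono : {homo series (exp_coeff (1 : R) : R^nat) : k l / (k <= l)%N >-> k <= l}.
  by apply/nondecreasing_seqP => k; rewrite seriesSr lerDl.
rewrite (nondecreasing_cvgn_le mono cv) /=.
apply: limr_le => //; near=> k.
have lemk : (m <= k)%N by near: k; exact: nbhs_infty_ge.
suff : series (exp_coeff (1 : R)) k + 2 / k`!%:R
    <= series (exp_coeff (1 : R)) m + 2 / m`!%:R.
  by apply: le_trans; rewrite lerDl divr_ge0.
rewrite -(subnKC lemk); elim: (k - m)%N => [|d IH]; first by rewrite addn0.
apply: le_trans IH; rewrite addnS seriesSr -addrA lerD2l.
rewrite /exp_coeff /= expr1n factS natrM invfM.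
set y := (_`!%:R)^-1; set x := _^-1.
have y0 : 0 <= y by rewrite invr_ge0.
have x2 : x <= 2^-1.
  by rewrite lef_pV2 ?posrE ?ltr0n // ler_nat; lia.
nra.
Unshelve. all: by end_near. Qed.

(** Locating 100 / e^2 within 1/200 of 13.53 amounts to 2.7181 < e < 2.7191, up
    to rounding; the bounds are fractions of small denominator that suffice,
    and eight terms of the series separate them from e. *)
Lemma expR1_bounds (R : realType) : 299 / 110 <= expR (1 : R) <= 87 / 32.
Proof.
have /andP[] := @exp_partial_sum_bounds R 8 isT.
rewrite /series /= !big_nat_recr //= big_nil /exp_coeff /= !expr1n.
rewrite !factS fact0 !natrM => lo hi.
apply/andP; split; [apply: le_trans lo|apply: le_trans hi _]; lra.
Qed.

Lemma percentage_bound (R : realType) :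
  `|100%:R / expR 1 ^+ 2 - 1353%:R / 100%:R : R| <= 1 / 200%:R.
Proof.
have /andP[lo hi] := expR1_bounds R.
have e2_gt0 : 0 < expR 1 ^+ 2 :> R by rewrite exprn_gt0 // expR_gt0.
rewrite ler_distl; apply/andP; split.
  by rewrite ler_pdivlMr //; nra.
by rewrite ler_pdivrMr //; nra.
Qed.

Theorem theorem1p1 (R : realType) :
  [/\ config_expectation (fun B : {set square n} => (num_safe B)%:R : R) / n%:R ^+ 2
        @[n --> \oo] --> 1 / expR 1 ^+ 2,
      config_expectation (fun B : {set square n} =>
          100%:R * ((num_safe B)%:R / n%:R ^+ 2) : R)
        @[n --> \oo] --> 100%:R / expR 1 ^+ 2
    & `|100%:R / expR 1 ^+ 2 - 1353%:R / 100%:R : R| <= 1 / 200%:R ].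
Proof.
have e2 : expR (- 2) = 1 / expR 1 ^+ 2 :> R.
  by rewrite expRN -expRM_natl mulr1 div1r.
have cvg_mean : config_expectation
    (fun B : {set square n} => (num_safe B)%:R : R) / n%:R ^+ 2
    @[n --> \oo] --> 1 / expR 1 ^+ 2.
  (* The quotient equals the probability only for n > 0, hence the shift. *)
  rewrite -e2 -cvg_shiftS (eq_cvg _ _ (g := fun n => safe_prob R n.+1)).
    by rewrite (cvg_shiftS (safe_prob R)); exact: cvg_safe_prob.
  by move=> n; rewrite /= config_expectation_num_safe mulrAC divff ?mul1r //.
split; [exact: cvg_mean| |exact: percentage_bound].
rewrite -[_^-1]div1r.
rewrite (eq_cvg _ _ (g := fun n => 100%:R * (config_expectation
  (fun B : {set square n} => (num_safe B)%:R : R) / n%:R ^+ 2))); last first.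
  move=> n; rewrite config_expectationZ; congr (100%:R * _).
  rewrite mulrC -config_expectationZ; apply: eq_bigr => B _.
  by rewrite [X in _ * X]mulrC.
by apply: cvgMl_tmp; exact: cvg_mean.
Qed.
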